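(* Let $(E,\kappa)$ and $(B,\lambda)$ be connected digital images, let $p:(E,\kappa)\to(B,\lambda)$ be a digital $(\kappa,\lambda)$-covering map, and let $n\ge 1$ be an integer. Then $p$ is a radius $n$ covering map if and only if every lifting to $E$ of any simple $\lambda$-loop in $B$ of length at most $2n+1$ is a simple $\kappa$-loop.
   Context: A digital image $(X,\kappa)$ is a set $X\subseteq\mathbb{Z}^d$ (for some $d$) with an adjacency relation $\kappa$ (a symmetric, irreflexive relation) on its points. $X$ is connected if any two distinct points are joined by a finite sequence of points of $X$ with consecutive ones $\kappa$-adjacent. A function $f:(X,\kappa)\to(Y,\lambda)$ is $(\kappa,\lambda)$-continuous if whenever $x,x'$ are $\kappa$-adjacent, either $f(x)=f(x')$ or $f(x),f(x')$ are $\lambda$-adjacent. It is a $(\kappa,\lambda)$-isomorphism if it is a continuous bijection with $(\lambda,\kappa)$-continuous inverse (subsets carry the restricted adjacency). $[a,b]_{\mathbb{Z}}=\{z\in\mathbb{Z}: a\le z\le b\}$ for integers $a<b$, with adjacency given by $|z-z'|=1$. A $\kappa$-path of length $m$ in $X$ is a continuous map $\alpha:[0,m]_{\mathbb{Z}}\to X$; it is a $\kappa$-loop (closed) if $\alpha(0)=\alpha(m)$. A $\kappa$-loop $\alpha:[0,m]_{\mathbb{Z}}\to X$ is simple if it traverses a simple closed $\kappa$-curve of $m$ points, i.e. $\alpha(0),\dots,\alpha(m-1)$ are distinct and, for $i,j\in[0,m-1]_{\mathbb{Z}}$, $\alpha(i)$ and $\alpha(j)$ are $\kappa$-adjacent if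 and only if $j\equiv i\pm1 \pmod m$. A lifting of a $\lambda$-path $\alpha:[0,m]_{\mathbb{Z}}\to B$ is a $\kappa$-path $\widetilde\alpha:[0,m]_{\mathbb{Z}}\to E$ with $p\circ\widetilde\alpha=\alpha$. For an integer $r\ge1$, $N_\kappa(x,r)$ is the set consisting of $x$ and all points $y\in X$ such that the shortest $\kappa$-path in $X$ from $x$ to $y$ has length at most $r$. For an integer $r\ge 1$, a $(\kappa,\lambda)$-continuous surjection $p:E\to B$ is a radius $r$ covering map if for each $b\in B$ there is an index set $M$ and points $e_i\in p^{-1}(b)$ ($i\in M$) such that: (1) $p^{-1}(N_\lambda(b,r))=\bigcup_{i\in M}N_\kappa(e_i,r)$; (2) $N_\kappa(e_i,r)\cap N_\kappa(e_j,r)=\emptyset$ for $i\neq j$ in $M$; (3) for every $i\in M$ the restriction $p|_{N_\kappa(e_i,r)}:N_\kappa(e_i,r)\to N_\lambda(b,r)$ is a $(\kappa,\lambda)$-isomorphism. A digital $(\kappa,\lambda)$-covering map is a radius $1$ covering map. *)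

(* Defs.v *)
From mathcomp Require Export all_boot all_order all_algebra.
From mathcomp Require Export boolp classical_sets functions.

Set Implicit Arguments.
Unset Strict Implicit.
Unset Printing Implicit Defensive.

Import Order.TTheory GRing.Theory Num.Theory.
Local Open Scope classical_set_scope.
Local Open Scope ring_scope.

(* The adjacency is a relation on the whole of Z^d, but only its values on the
   points of the image are constrained or ever used. *)
Record digital_image (d : nat) := DigitalImage {
  points :> set 'rV[int]_d;
  adj : 'rV[int]_d -> 'rV[int]_d -> Prop;
  adj_sym : forall x y, points x -> points y -> adj x y -> adj y x;
  adj_irrefl : forall x, points x -> ~ adj x x
}.

Definition dconnected (d : nat) (X : digital_image d) : Prop :=
  forall x y, points X x -> points X y -> x <> y ->
  exists (m : nat) (u : nat -> 'rV[int]_d),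
    [/\ u 0%N = x, u m = y,
        forall i : nat, (i <= m)%N -> points X (u i)
      & forall i : nat, (i < m)%N -> adj X (u i) (u i.+1)].

(* Maps between images are total functions on the ambient types, considered
   only on the source set. Since A and C are arbitrary sets, this also covers
   subsets with the restricted adjacency. *)
Definition dcontinuous (T U : Type) (A : set T) (k : T -> T -> Prop)
    (C : set U) (l : U -> U -> Prop) (f : T -> U) : Prop :=
  set_fun A C f /\
  forall x x', A x -> A x' -> k x x' -> f x = f x' \/ l (f x) (f x').

Definition disomorphism (T U : Type) (A : set T) (k : T -> T -> Prop)
    (C : set U) (l : U -> U -> Prop) (f : T -> U) : Prop :=
  [/\ set_bij A C f, dcontinuous A k C l f
    & exists g : U -> T,
        [/\ {in A, cancel f g}, {in C, cancel g f} & dcontinuous C l A k g]].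

Definition zinterval (a b : int) : set int := [set z | a <= z <= b].

Definition zadj (z z' : int) : Prop := `|z - z'| = 1.

(* [0, m] is an integer interval only for 0 < m. *)
Definition dpath (d : nat) (X : digital_image d) (m : nat)
    (alpha : int -> 'rV[int]_d) : Prop :=
  (0 < m)%N /\ dcontinuous (zinterval 0 m%:Z) zadj X (adj X) alpha.

Definition dloop (d : nat) (X : digital_image d) (m : nat)
    (alpha : int -> 'rV[int]_d) : Prop :=
  dpath X m alpha /\ alpha 0 = alpha m%:Z.

Definition simple_loop (d : nat) (X : digital_image d) (m : nat)
    (alpha : int -> 'rV[int]_d) : Prop :=
  [/\ dloop X m alpha,
      set_inj (zinterval 0 (m%:Z - 1)) alpha
    & forall i j : int,
        zinterval 0 (m%:Z - 1) i -> zinterval 0 (m%:Z - 1) j ->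
        (adj X (alpha i) (alpha j) <->
           (j = i + 1 %[mod m%:Z])%Z \/ (j = i - 1 %[mod m%:Z])%Z)].

Definition path_between (d : nat) (X : digital_image d) (m : nat)
    (x y : 'rV[int]_d) : Prop :=
  exists alpha, [/\ dpath X m alpha, alpha 0 = x & alpha m%:Z = y].

Definition shortest_length (d : nat) (X : digital_image d)
    (x y : 'rV[int]_d) (m : nat) : Prop :=
  path_between X m x y /\ forall k : nat, path_between X k x y -> (m <= k)%N.

Definition dnbhd (d : nat) (X : digital_image d) (x : 'rV[int]_d) (r : nat) :
    set 'rV[int]_d :=
  [set y | y = x \/
     points X y /\ exists2 m : nat, shortest_length X x y m & (m <= r)%N].

Section Covering.
Variables (d d' : nat) (E : digital_image d) (B : digital_image d').
Variable p : 'rV[int]_d -> 'rV[int]_d'.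

Definition lifting (m : nat) (alpha : int -> 'rV[int]_d')
    (beta : int -> 'rV[int]_d) : Prop :=
  [/\ dpath B m alpha, dpath E m beta
    & forall i, zinterval 0 m%:Z i -> p (beta i) = alpha i].

(* The preimage of S under p : E -> B is E `&` p @^-1` S. *)
Definition radius_covering_map (r : nat) : Prop :=
  [/\ dcontinuous E (adj E) B (adj B) p, set_surj E B p
    & forall b, points B b ->
      exists (M : Type) (e : M -> 'rV[int]_d),
        [/\ forall i, (E `&` p @^-1` [set b]) (e i),
            E `&` p @^-1` (dnbhd B b r) = \bigcup_(i in setT) dnbhd E (e i) r,
            forall i j, i <> j -> dnbhd E (e i) r `&` dnbhd E (e j) r = set0
          & forall i, disomorphism (dnbhd E (e i) r) (adj E)
                                   (dnbhd B b r) (adj B) p]].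

Definition covering_map : Prop := radius_covering_map 1.

End Covering.

(* Main.v *)
Require Import Defs.
From mathcomp Require Import all_boot all_order all_algebra.
From mathcomp Require Import boolp classical_sets functions.
From mathcomp Require Import zify.

(** Both properties say that short closed walks of [B] lift to closed walks
of [E].

A digital covering has the unique path lifting property, because [p]
restricts to an isomorphism on every ball of radius 1.  From it, a lift of a
simple loop is simple as soon as it is closed ([closed_lift_simple]): a
repetition or a chord of the lift would project to one of the loop, and a lift
of an edge cannot be constant.

If [p] is a radius [n] covering, a loop of length at most [2 * n + 1] stays in
the ball of radius [n] around its base point, since every vertex is reached
from one end or the other in at most [n] steps.  The inverse of [p] on the
ball of [E] around the start of the lift carries the loop to a closed walk,
which by uniqueness is the lift ([radius_covering_closed_lift]).

Conversely, suppose that simple loops of length at most [2 * n + 1] lift to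
simple loops.  Then every closed walk of such a length lifts to a closed walk
([short_closed_walk_lift]), by induction on the length: a closed walk that is
not a simple loop has a repeated vertex or a chord, which cuts it into two
strictly shorter closed walks.  Hence [p] separates points of [E] joined by a
walk of length at most [2 * n + 1].  This gives a radius [n] covering indexed
by the whole fibre ([radius_covering_of_walk_inj]): two points of a ball of
radius [n], or the centres of two balls that meet, are joined by a walk of
length [2 * n], and the continuity of the inverse on a ball costs one step
more. *)

(** * Walks in a digital image *)

Set Implicit Arguments.
Unset Strict Implicit.
Unset Printing Implicit Defensive.

Import GRing.Theory.
Local Open Scope classical_set_scope.
Local Open Scope ring_scope.

Section Walks.
Variables (d : nat) (X : digital_image d).

(** Paths of a digital image may pause, so a step is allowed to be constant. *)
Definition step (x y : 'rV[int]_d) : Prop :=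
  [/\ points X x, points X y & x = y \/ adj X x y].

(** Paths of length [k], made inductive so that they concatenate without
re-indexing; unlike a digital path, a walk may have length 0. *)
Fixpoint walk (k : nat) (x y : 'rV[int]_d) : Prop :=
  if k is k'.+1 then exists2 z, step x z & walk k' z y else points X x /\ x = y.

Lemma step_refl x : points X x -> step x x.
Proof. by move=> Xx; split => //; left. Qed.

Lemma step_sym x y : step x y -> step y x.
Proof.
case=> Xx Xy [->|axy]; first exact: step_refl.
by split=> //; right; apply: adj_sym.
Qed.

Lemma walk_points k x y : walk k x y -> points X x /\ points X y.
Proof.
elim: k x => [|k IH] x /=; first by case=> Xx <-.
by case=> z [Xx _ _] /IH[_ Xy].
Qed.

Lemma walk1 x y : walk 1 x y <-> step x y.
Proof.
split=> [[z xz [_ <-]] // | xy].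
by exists y => //; case: xy.
Qed.

Lemma walk_cat k l x y z : walk k x y -> walk l y z -> walk (k + l) x z.
Proof.
elim: k x => [|k IH] x /=; first by case=> _ ->.
by case=> w xw wy yz; exists w => //; apply: IH.
Qed.

Lemma walk_sym k x y : walk k x y -> walk k y x.
Proof.
elim: k x => [|k IH] x; first by case=> Xx <-.
case=> z xz /IH yz; rewrite -(addn1 k); apply: walk_cat yz _.
by apply/walk1/step_sym.
Qed.

Lemma walk_le k l x y : (k <= l)%N -> walk k x y -> walk l x y.
Proof.
move=> /subnK <-; elim: (l - k)%N => [//|j IH] /IH xy; rewrite addSn.
by exists x => //; apply: step_refl; case: (walk_points xy).
Qed.

Lemma walk_of_fun (u : nat -> 'rV[int]_d) m i k :
  (forall j, (j < m)%N -> step (u j) (u j.+1)) -> (0 < m)%N ->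
  (i + k <= m)%N -> walk k (u i) (u (i + k)%N).
Proof.
move=> us m0; elim: k => [|k IH] ikm.
  rewrite addn0 /=; split=> //; move: ikm; rewrite addn0 leq_eqVlt.
  case/orP=> [/eqP->|/us[]//].
  by case: m us m0 => // m us _; case: (us m (ltnSn m)).
rewrite addnS -addn1; apply: walk_cat (IH _) _; first by lia.
by apply/walk1/us; lia.
Qed.

Lemma walk_fun k x y : walk k x y ->
  exists u : nat -> 'rV[int]_d,
    [/\ u 0%N = x, u k = y & forall i, (i < k)%N -> step (u i) (u i.+1)].
Proof.
elim: k x => [|k IH] x /=.
  by case=> _ <-; exists (fun=> x).
case=> z xz /IH [u [u0 uk us]].
exists (fun i => if i is i'.+1 then u i' else x); split=> // -[_|i ik].
  by rewrite u0.
exact: us.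
Qed.

Lemma dpathP m (alpha : int -> 'rV[int]_d) :
  dpath X m alpha <-> (0 < m)%N /\
    forall i : nat, (i < m)%N -> step (alpha i%:Z) (alpha i.+1%:Z).
Proof.
split=> [[m0 [aX ac]]|[m0 us]]; split=> //.
  move=> i im.
  have Ii : zinterval 0 m%:Z i%:Z by rewrite /zinterval /=; lia.
  have Ii1 : zinterval 0 m%:Z i.+1%:Z by rewrite /zinterval /=; lia.
  by split; [exact: aX|exact: aX|apply: ac => //; rewrite /zadj; lia].
have aX (i : nat) : (i <= m)%N -> points X (alpha i%:Z).
  move=> im; have := @walk_of_fun (fun i : nat => alpha i%:Z) m i 0 us m0.
  by rewrite addn0 => /(_ im) [].
have aZ z : zinterval 0 m%:Z z -> points X (alpha z).
  rewrite /zinterval /= => zm; have -> : z = `|z|%N%:Z by lia.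
  by apply: aX; lia.
split=> [z /aZ //|z z'].
wlog zz : z z' / z' = z + 1.
  move=> H Iz Iz' a; have [e|e] : z' = z + 1 \/ z = z' + 1.
      by move: a; rewrite /zadj; lia.
    exact: H.
  have a2 : zadj z' z by rewrite /zadj; lia.
  have [|->|a3] := H z' z _ Iz' Iz a2; [by []|by left|].
  by right; apply: adj_sym => //; apply: aZ.
rewrite {}zz /zinterval /= => Iz Iz' _.
have [|_ _] := us `|z|%N; first by lia.
have -> : `|z|%N.+1%:Z = z + 1 by lia.
by have -> : `|z|%N%:Z = z by lia.
Qed.

Lemma path_betweenP m x y :
  path_between X m x y <-> (0 < m)%N /\ walk m x y.
Proof.
split=> [[a [/dpathP[m0 us] <- <-]]|[m0 /walk_fun [u [u0 um us]]]].
  split=> //.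
  exact: (@walk_of_fun (fun i : nat => a i%:Z) m 0 m).
exists (fun i => u `|i|%N); split=> //.
by apply/dpathP; split=> // i /us.
Qed.

(** A walk can be prolonged by pausing, so that there is a walk of length
exactly [r] as soon as the shortest path has length at most [r]. *)
Lemma dnbhdP r x y : (0 < r)%N -> points X x -> dnbhd X x r y <-> walk r x y.
Proof.
move=> r0 Xx; split.
  case=> [->|[Xy [m [/path_betweenP[_ xy] _] mr]]].
    by apply: (@walk_le 0).
  exact: walk_le xy.
move=> xy; right; split; first by case: (walk_points xy).
have ex : exists m, `[< path_between X m x y >].
  by exists r; apply/asboolP/path_betweenP.
exists (ex_minn ex); case: ex_minnP => m /asboolP xmy mmin.
  by split=> // k xky; apply/mmin/asboolP.
by apply/mmin/asboolP/path_betweenP.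
Qed.

Definition cyclic_succ (m i j : nat) : Prop :=
  j = i.+1 \/ (i.+1 = m /\ j = 0)%N.

Lemma cyclic_succE (m i j : nat) : (i < m)%N -> (j < m)%N ->
  (j%:Z = i%:Z + 1 %[mod m%:Z])%Z <-> cyclic_succ m i j.
Proof.
move=> im jm; rewrite /cyclic_succ.
have -> : i%:Z + 1 = i.+1%:Z by lia.
rewrite !modz_nat modn_small //.
have [im'|im'] := ltnP i.+1 m.
  by rewrite modn_small //; split=> [[->]|[->//|]]; [left|lia].
have -> : i.+1 = m by lia.
by rewrite modnn; split=> [[->]|[|[_ ->//]]]; [right|lia].
Qed.

Lemma cyclic_predE (m i j : nat) : (i < m)%N -> (j < m)%N ->
  (j%:Z = i%:Z - 1 %[mod m%:Z])%Z <-> cyclic_succ m j i.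
Proof.
move=> im jm; rewrite -cyclic_succE //.
have shift : (j%:Z == i%:Z - 1 %[mod m])%Z = (j%:Z + 1 == i%:Z %[mod m])%Z.
  by rewrite -(eqz_modDr 1) subrK.
split=> [/eqP|/esym/eqP]; first by rewrite shift => /eqP.
by rewrite -shift => /eqP.
Qed.

(** Turns the congruences on integer indices into a successor relation on
natural numbers, on which cases can be made. *)
Lemma simple_loopP m (alpha : int -> 'rV[int]_d) :
  simple_loop X m alpha <->
  [/\ (0 < m)%N,
      forall i : nat, (i < m)%N -> step (alpha i%:Z) (alpha i.+1%:Z),
      alpha 0 = alpha m%:Z,
      forall i j : nat, (i < m)%N -> (j < m)%N ->
        alpha i%:Z = alpha j%:Z -> i = j
    & forall i j : nat, (i < m)%N -> (j < m)%N ->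
        adj X (alpha i%:Z) (alpha j%:Z) <->
        cyclic_succ m i j \/ cyclic_succ m j i].
Proof.
split=> [[[/dpathP[m0 us] cl] inj ad]|[m0 us cl inj ad]].
  have I (i : nat) : (i < m)%N -> zinterval 0 (m%:Z - 1) i%:Z.
    by rewrite /zinterval /=; lia.
  split=> // i j im jm.
    by move=> /inj; rewrite !inE => /(_ (I _ im) (I _ jm)) [].
  by rewrite ad; [rewrite cyclic_succE // cyclic_predE|exact: I|exact: I].
split; first by split=> //; apply/dpathP.
  move=> i j; rewrite !inE /zinterval /= => Ii Ij.
  have -> : i = `|i|%N%:Z by lia.
  have -> : j = `|j|%N%:Z by lia.
  by move=> /inj -> //; lia.
move=> i j; rewrite /zinterval /= => Ii Ij.
have -> : i = `|i|%N%:Z by lia.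
have -> : j = `|j|%N%:Z by lia.
by rewrite cyclic_succE ?cyclic_predE ?ad //; lia.
Qed.

End Walks.

(** * Unique lifting of walks *)

Section Coverings.
Variables (d d' : nat) (E : digital_image d) (B : digital_image d').
Variable p : 'rV[int]_d -> 'rV[int]_d'.

(** The balls upstairs are only given around some points of each fibre, but
their centres exhaust the fibre: [x] lies in one of these balls, with the same
image as its centre, and [p] is injective there. *)
Lemma radius_covering_iso r x : (0 < r)%N -> radius_covering_map E B p r ->
  points E x ->
  disomorphism (dnbhd E x r) (adj E) (dnbhd B (p x) r) (adj B) p.
Proof.
move=> r0 [[pB _] _ cov] Ex.
have ctr (d0 : nat) (X : digital_image d0) y : dnbhd X y r y by left.
have [M [e [fib pre _ iso]]] := cov _ (pB _ Ex).
have [i _ xi] : (\bigcup_(i in setT) dnbhd E (e i) r) x.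
  by rewrite -pre; split=> //=; apply: ctr.
suff xi_ctr : x = e i by move: (iso i); rewrite -xi_ctr.
have [[_ inj _] _ _] := iso i.
by apply: inj; rewrite ?inE //; have [_ /= ->] := fib i.
Qed.

Section LiftingWalks.
Hypothesis hp : covering_map E B p.

Lemma covering_step x y : step E x y -> step B (p x) (p y).
Proof.
have [[pB pc] _ _] := hp.
case=> Ex Ey xy; split; [exact: pB|exact: pB|].
by case: xy => [->|/pc]; [left|apply].
Qed.

Lemma covering_walk k x y : walk E k x y -> walk B k (p x) (p y).
Proof.
have [[pB _] _ _] := hp.
elim: k x => [|k IH] x /=; first by case=> Ex <-; split=> //; apply: pB.
by case=> z /covering_step xz /IH zy; exists (p z).
Qed.

Lemma covering_step_inj x y z :
  step E x y -> step E x z -> p y = p z -> y = z.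
Proof.
move=> xy xz; have Ex : points E x by case: xy.
have [[_ inj _] _ _] := radius_covering_iso (ltn0Sn 0) hp Ex.
by apply: inj; rewrite inE; apply/dnbhdP => //; apply/walk1.
Qed.

Lemma covering_step_lift x b :
  points E x -> step B (p x) b -> exists2 y, step E x y & p y = b.
Proof.
move=> Ex xb; have Bx : points B (p x) by case: xb.
have [[_ _ surj] _ _] := radius_covering_iso (ltn0Sn 0) hp Ex.
have [|y xy <-] := surj b; first by apply/dnbhdP => //; apply/walk1.
by exists y => //; apply/walk1/dnbhdP.
Qed.

Lemma covering_walk_lift k x b :
  points E x -> walk B k (p x) b -> exists2 y, walk E k x y & p y = b.
Proof.
elim: k x => [|k IH] x Ex /=; first by case=> _ <-; exists x.
case=> c /(covering_step_lift Ex)[z xz <-] /IH[|y zy yb].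
  by case: xz.
by exists y => //; exists z.
Qed.

Lemma covering_unique_lift (u v : nat -> 'rV[int]_d) m :
  (forall i, (i < m)%N -> step E (u i) (u i.+1)) ->
  (forall i, (i < m)%N -> step E (v i) (v i.+1)) ->
  (forall i, (i <= m)%N -> p (u i) = p (v i)) ->
  u 0%N = v 0%N -> forall i, (i <= m)%N -> u i = v i.
Proof.
move=> us vs uv uv0; elim=> [//|i IH] im.
apply: (covering_step_inj (us _ im)); last exact: uv.
by rewrite IH; [exact: vs|exact: ltnW].
Qed.

(** * Lifts of loops *)

(** The closing edge is the only one that a lift could lose; the others lift to
steps of [E], which are not constant because [p] separates their ends. *)
Lemma closed_lift_simple m alpha beta :
  simple_loop B m alpha -> lifting E B p m alpha beta ->
  beta 0 = beta m%:Z -> simple_loop E m beta.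
Proof.
move=> /simple_loopP[m0 us cl inj ad] [_ /dpathP[_ bs] pb] bcl.
have pbn (i : nat) : (i <= m)%N -> p (beta i%:Z) = alpha i%:Z.
  by move=> im; apply: pb; rewrite /zinterval /=; lia.
have Eb (i : nat) : (i < m)%N -> points E (beta i%:Z) by case/bs.
have succ_adj (i j : nat) : (i < m)%N -> (j < m)%N -> cyclic_succ m i j ->
    adj E (beta i%:Z) (beta j%:Z).
  move=> im jm ij.
  have [_ _ [e|//]] : step E (beta i%:Z) (beta j%:Z).
    by case: ij => [->|[im1 ->]]; [|rewrite bcl -[in m%:Z]im1]; apply: bs.
  have [_ /(_ (or_introl ij))] := ad i j im jm.
  rewrite -(pbn i (ltnW im)) e (pbn j (ltnW jm)) => /adj_irrefl[].
  by case: (us j jm).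
apply/simple_loopP; split=> // i j im jm.
  by move=> e; apply: inj => //; rewrite -(pbn i (ltnW im)) e pbn // ltnW.
split=> [bij|[ij|ji]].
- apply/(ad i j im jm); rewrite -(pbn i (ltnW im)) -(pbn j (ltnW jm)).
  have [[_ pc] _ _] := hp.
  case: (pc _ _ (Eb i im) (Eb j jm) bij) => // e.
  have ij : i = j.
    by apply: inj => //; rewrite -(pbn i (ltnW im)) e pbn // ltnW.
  by case: (@adj_irrefl _ E (beta i%:Z)); [exact: Eb|rewrite {2}ij].
- exact: succ_adj.
- by apply: adj_sym; [exact: Eb|exact: Eb|exact: succ_adj].
Qed.

(** A vertex of a loop of length at most [2 * n + 1] is at distance at most [n]
from the base point, forwards or backwards along the loop.  The loop thus lies
in one ball, and the inverse of [p] on the ball above it gives a closed lift;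
by uniqueness there is no other. *)
Lemma radius_covering_closed_lift n m alpha beta :
  (0 < n)%N -> radius_covering_map E B p n ->
  dloop B m alpha -> (m <= 2 * n + 1)%N -> lifting E B p m alpha beta ->
  beta 0 = beta m%:Z.
Proof.
move=> n0 hpn [/dpathP[m0 us] cl] mn [_ /dpathP[_ bs] pb].
have pbn (i : nat) : (i <= m)%N -> p (beta i%:Z) = alpha i%:Z.
  by move=> im; apply: pb; rewrite /zinterval /=; lia.
have Eb0 : points E (beta 0) by case: (bs 0%N m0).
have Ba0 : points B (alpha 0) by case: (us 0%N m0).
have pb0 : p (beta 0) = alpha 0 by exact: (pbn 0%N).
have := radius_covering_iso n0 hpn Eb0.
rewrite pb0 => -[[_ inj _] _ [g [_ gK [gE gc]]]].
have near (i : nat) : (i <= m)%N -> dnbhd B (alpha 0) n (alpha i%:Z).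
  move=> im; apply/dnbhdP => //.
  have [i_le|n_lt] := leqP i n.
    apply: walk_le i_le _.
    exact: (@walk_of_fun _ B (fun i : nat => alpha i%:Z) m 0 i).
  have mi : (m - i <= n)%N by lia.
  apply: walk_le mi _; apply: walk_sym; rewrite cl.
  rewrite -[X in walk _ _ _ (alpha X%:Z)](subnKC im).
  apply: (@walk_of_fun _ B (fun i : nat => alpha i%:Z) m) => //.
  by rewrite subnKC.
have Egamma (i : nat) : (i <= m)%N -> dnbhd E (beta 0) n (g (alpha i%:Z)).
  by move=> /near /gE.
have EN x : dnbhd E (beta 0) n x -> points E x.
  by move=> /(dnbhdP _ n0 Eb0)/walk_points[].
have pg (i : nat) : (i <= m)%N -> p (g (alpha i%:Z)) = alpha i%:Z.
  by move=> /near Ni; apply: gK; rewrite inE.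
have gs (i : nat) : (i < m)%N -> step E (g (alpha i%:Z)) (g (alpha i.+1%:Z)).
  move=> im; have im' := ltnW im.
  split; [exact/EN/Egamma|exact/EN/Egamma|].
  have [_ _ [->|a]] := us i im; first by left.
  by apply: gc => //; apply: near.
have g0 : g (alpha 0) = beta 0.
  apply: inj; rewrite ?inE; [exact: (Egamma 0%N)|by left|].
  by rewrite pb0; apply: (pg 0%N).
have := @covering_unique_lift (fun i : nat => beta i%:Z)
  (fun i : nat => g (alpha i%:Z)) m bs gs.
move=> /(_ _ (esym g0) m (leqnn m)) -> => [|i im].
  by rewrite -cl g0.
by rewrite pbn // pg.
Qed.

(** A shortest counterexample would project to a simple loop.  At a repeated
vertex of the projection, the subwalk between the repetitions lifts to a closed
walk, and cutting it out gives a shorter counterexample.  At a chord from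
[p (u i)] to [p (u j)], the subwalk from [u i] to [u j] followed by a lift of
the chord is shorter, hence closed; so [u i] and [u j] are adjacent, and the
step between them shortens the walk. *)
Lemma short_closed_walk_lift N x y k :
  (forall m alpha beta, simple_loop B m alpha -> (m <= N)%N ->
     lifting E B p m alpha beta -> simple_loop E m beta) ->
  (k <= N)%N -> walk E k x y -> p x = p y -> x = y.
Proof.
move=> simple_lifts; elim/ltn_ind: k x y => k IH x y kN xy pxy.
have [k1|k1] := leqP k 1.
  apply: covering_step_inj pxy; last by apply/walk1; apply: walk_le xy.
  by apply: step_refl; case: (walk_points xy).
have [u [u0 uk us]] := walk_fun xy.
have sub i j : (i <= j)%N -> (j <= k)%N -> walk E (j - i) (u i) (u j).
  move=> ij jk; rewrite -[in u j](subnKC ij).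
  by apply: walk_of_fun us _ _; [lia|rewrite subnKC].
have shortcut i j : (i + 2 <= j)%N -> (j < k)%N -> step E (u i) (u j) -> x = y.
  move=> ij jk uij; apply: (IH (i + (1 + (k - j)))%N); [lia|lia| |exact: pxy].
  rewrite -u0 -uk.
  have := sub 0%N i; rewrite subn0 => /(_ isT) w.
  apply: walk_cat (w _) _; first by lia.
  by apply: walk_cat (sub _ _ _ _); [apply/walk1|lia|].
(* A pause of the walk is a repetition too; the pair of both ends is
   excluded because cutting there would not shorten the walk. *)
have [[i [j [ij jk ne puij]]]|norep] := pselect (exists i j,
    [/\ (i < j)%N, (j <= k)%N, (i, j) <> (0, k)%N & p (u i) = p (u j)]).
  have shorter : (j - i < k)%N.
    have /orP[i0|jk'] : (0 < i)%N || (j < k)%N; [|lia|lia].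
    case: i j ij jk ne puij => [|i] j _ jk ne _ //=.
    by rewrite ltn_neqAle jk andbT; apply/eqP => e; rewrite e in ne.
  have uij : u i = u j.
    by apply: (IH _ shorter) puij; [lia|apply: sub => //; apply: ltnW].
  apply: (IH (i + (k - j))%N); [lia|lia| |exact: pxy].
  rewrite -u0 -uk; have := sub 0%N i; rewrite subn0 => /(_ isT) w.
  apply: walk_cat (w _) _; first by lia.
  by rewrite uij; apply: sub.
have inj i j : (i < k)%N -> (j < k)%N -> p (u i) = p (u j) -> i = j.
  move=> ik jk e; apply: contrapT => ne; apply: norep.
  have [ij|ji] : (i < j)%N \/ (j < i)%N by lia.
    by exists i, j; split=> //; [lia|case; lia].
  by exists j, i; split=> //; [lia|case; lia].
have pus i : (i < k)%N -> adj B (p (u i)) (p (u i.+1)).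
  move=> ik; have [_ _ [e|//]] := covering_step (us i ik).
  by case: norep; exists i, i.+1; split=> //; case; lia.
have pcl : p (u 0%N) = p (u k) by rewrite u0 uk.
have Eu i : (i < k)%N -> points E (u i) by case/us.
have Bu i : (i < k)%N -> points B (p (u i)).
  by move=> ik; case: (covering_step (us i ik)).
(* The pair [(0, k.-1)] is the closing edge of the loop, not a chord. *)
have [[i [j [ij jk ne aij]]]|nochord] := pselect (exists i j,
    [/\ (i + 2 <= j)%N, (j < k)%N, (i, j) <> (0, k.-1)%N
      & adj B (p (u i)) (p (u j))]).
  have ik : (i < k)%N by lia.
  have [|z uz pz] := @covering_step_lift (u j) (p (u i)) (Eu j jk).
    by split; [exact: Bu|exact: Bu|right; apply: adj_sym => //; exact: Bu].
  have shorter : (j - i + 1 < k)%N.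
    have /orP[i0|jk'] : (0 < i)%N || (j < k.-1)%N; [|lia|lia].
    case: i j ij jk ne {ik aij uz pz} => [|i] j _ jk ne //=.
    rewrite ltn_neqAle; apply/andP; split; last by lia.
    by apply/eqP => e; rewrite e in ne.
  have uiz : u i = z.
    apply: (IH _ shorter) (esym pz); first by lia.
    by apply: walk_cat (sub i j _ _) _; [lia|lia|apply/walk1].
  apply: shortcut ij jk _; rewrite uiz; exact: step_sym.
have closed : simple_loop E k (fun i => u `|i|%N).
  apply: (simple_lifts k (fun i => p (u `|i|%N))) => //; last first.
    split=> //; first apply/dpathP; last apply/dpathP; split=> //=; try lia.
    by move=> i /us /covering_step.
  apply/simple_loopP; split=> //=; [lia|by move=> i /us /covering_step|].
  have fwd i j : (i < j)%N -> (j < k)%N -> adj B (p (u i)) (p (u j)) ->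
      cyclic_succ k i j \/ cyclic_succ k j i.
    move=> ij jk a; rewrite /cyclic_succ.
    have [->|ij2] : j = i.+1 \/ (i + 2 <= j)%N by lia.
      by left; left.
    right; right; apply: contrapT => ne; apply: nochord.
    exists i, j; split=> //.
    by case=> ? ?; apply: ne; lia.
  have bwd i j : (i < k)%N -> (j < k)%N -> cyclic_succ k i j ->
      adj B (p (u i)) (p (u j)).
    move=> ik jk [->|[ik1 ->]]; first exact: pus.
    by rewrite pcl -[in u k]ik1; apply: pus.
  move=> i j ik jk; split.
    move=> a; have [e|[ij|ji]] : i = j \/ (i < j)%N \/ (j < i)%N by lia.
    - by case: (@adj_irrefl _ B (p (u i)) (Bu i ik)); rewrite {2}e.
    - exact: fwd.
    - by apply/or_comm; apply: fwd => //; apply: adj_sym => //; exact: Bu.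
  by case=> [|h]; [exact: bwd|apply: adj_sym; [exact: Bu|exact: Bu|exact: bwd]].
by have [[_ /= cl] _ _] := closed; rewrite -u0 -uk.
Qed.

(** The length [2 * n + 1], rather than [2 * n], is what the continuity of the
inverse needs: the lift of an edge from one point of a ball and the point of
the ball above the other end of the edge are joined by going through the
centre and then along the lifted edge. *)
Lemma radius_covering_of_walk_inj n : (0 < n)%N ->
  (forall x y, walk E (2 * n + 1) x y -> p x = p y -> x = y) ->
  radius_covering_map E B p n.
Proof.
move=> n0 winj; have [pcont psurj _] := hp; have [pB pc] := pcont.
have meet x y k l z : (k + l <= 2 * n + 1)%N -> walk E k x z -> walk E l y z ->
    p x = p y -> x = y.
  move=> kl xz yz; apply: winj; apply: walk_le kl _.
  by apply: walk_cat xz _; apply: walk_sym.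
split=> // b Bb.
(* Every point of the fibre is the centre of a ball. *)
exists {x | (E `&` p @^-1` [set b]) x}, sval; split.
- exact: svalP.
- apply/seteqP; split=> x /=.
    case=> Ex /(dnbhdP _ n0 Bb)/walk_sym/(covering_walk_lift Ex)[y xy yb].
    have Ey : points E y by case: (walk_points xy).
    exists (exist _ y (conj Ey yb)) => //=.
    by apply/dnbhdP => //; apply: walk_sym.
  case=> -[y [Ey yb]] _ /= /(dnbhdP _ n0 Ey) yx; split.
    by case: (walk_points yx).
  by apply/dnbhdP => //; rewrite -yb; apply: covering_walk.
- move=> [x [Ex xb]] [y [Ey yb]] ne /=; apply/seteqP; split=> // z [] /=.
  move=> /(dnbhdP _ n0 Ex) xz /(dnbhdP _ n0 Ey) yz; apply: ne.
  have e : x = y by apply: meet xz yz _; [lia|rewrite xb yb].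
  by case: _ / e Ey yb {yz} => Ey yb; congr exist; apply: Prop_irrelevance.
move=> [x [Ex xb]] /=; rewrite -xb.
have Bx := pB _ Ex.
have NE y : dnbhd E x n y -> points E y.
  by move=> /(dnbhdP _ n0 Ex)/walk_points[].
have Nfun : set_fun (dnbhd E x n) (dnbhd B (p x) n) p.
  by move=> y /(dnbhdP _ n0 Ex) xy; apply/dnbhdP => //; apply: covering_walk.
have Ninj : set_inj (dnbhd E x n) p.
  move=> y z; rewrite !inE.
  move=> /(dnbhdP _ n0 Ex)/walk_sym xy /(dnbhdP _ n0 Ex)/walk_sym xz.
  by apply: meet xy xz; lia.
have Nsurj : set_surj (dnbhd E x n) (dnbhd B (p x) n) p.
  move=> c /(dnbhdP _ n0 Bx)/(covering_walk_lift Ex)[y xy yc].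
  by exists y => //; apply/dnbhdP.
split; first by split.
  split=> // y z /NE Ey /NE Ez; exact: pc.
pose g c := xget x [set y | dnbhd E x n y /\ p y = c].
have gP c : dnbhd B (p x) n c -> dnbhd E x n (g c) /\ p (g c) = c.
  by case/Nsurj => y Ny yc; rewrite /g; case: xgetP => [_ -> []|/(_ y)[]].
exists g; split.
- move=> y; rewrite inE => Ny; have [Ng pg] := gP _ (Nfun _ Ny).
  by apply: Ninj; rewrite ?inE.
- by move=> c; rewrite inE => /gP[].
split=> [c /gP[]//|c c' Nc Nc' cc'].
have [Ng pg] := gP _ Nc; have [Ng' pg'] := gP _ Nc'.
have [|z [_ Ez gz] zc'] := @covering_step_lift (g c) c' (NE _ Ng).
  rewrite pg; split; last by right.
    by rewrite -pg; apply: pB; apply: NE.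
  by rewrite -pg'; apply: pB; apply: NE.
(* The lift [z] of the edge might leave the ball, so that injectivity of [p]
   on the ball would not be enough. *)
suff -> : g c' = z by [].
apply: winj; last by rewrite pg' zc'.
have -> : (2 * n + 1 = n + (n + 1))%N by lia.
move: Ng Ng' => /(dnbhdP _ n0 Ex) xg /(dnbhdP _ n0 Ex)/walk_sym xg'.
apply: walk_cat xg' (walk_cat xg _).
by apply/walk1; split=> //; case: (walk_points xg).
Qed.

End LiftingWalks.
End Coverings.

Theorem theorem4p5 (d d' : nat) (E : digital_image d) (B : digital_image d')
    (p : 'rV[int]_d -> 'rV[int]_d') (n : nat)
    (hE : dconnected E) (hB : dconnected B)
    (hp : covering_map E B p) (hn : (1 <= n)%N) :
  radius_covering_map E B p n <->
  (forall (m : nat) (alpha : int -> 'rV[int]_d') (beta : int -> 'rV[int]_d),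
     simple_loop B m alpha -> (m <= 2 * n + 1)%N ->
     lifting E B p m alpha beta -> simple_loop E m beta).
Proof.
split=> [hpn m alpha beta sa mn lift|simple_lifts].
  apply: (closed_lift_simple hp sa lift); have [la _ _] := sa.
  exact: (radius_covering_closed_lift hp hn hpn la mn lift).
apply: (radius_covering_of_walk_inj hp hn) => x y.
exact: (short_closed_walk_lift hp simple_lifts).
Qed.
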